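(* Let $0<\epsilon<1/50$ and let $V,E,D,N$ be positive integers. Consider a random GBS graph with parameters $V,E,D,N$. Suppose that $E\ge V^{2+\epsilon}$, $E\ge e^{2D/\epsilon^2}$ and $N\ge E^4$. Then the GBS graph is connected and flexible with probability at least $1-\frac{1}{E^{\epsilon/8}}$.
   Context: A graph $\Gamma$ consists of a vertex set $V(\Gamma)$, a set $E(\Gamma)$ of (oriented) edges, a reverse map $e\mapsto\overline{e}$ on $E(\Gamma)$ with $\overline{e}\neq e$ and $\overline{\overline{e}}=e$, and an initial vertex map $\iota:E(\Gamma)\to V(\Gamma)$; the terminal vertex is $\tau(e)=\iota(\overline{e})$. A topological edge is a pair $\{e,\overline e\}$. Loops and multiple edges are allowed. A GBS graph is a pair $(\Gamma,\psi)$ with $\Gamma$ a finite graph and $\psi:E(\Gamma)\to\mathbb{Z}\setminus\{0\}$; $\psi(e)$ is the label on $e$ near $\tau(e)$. When $\Gamma$ is connected, the GBS group represented by $(\Gamma,\psi)$ is defined as follows. Choose a maximal tree $T=\overline{T}\subseteq E(\Gamma)$. The generators are $a_v$ for $v\in V(\Gamma)$ and $t_e$ for $e\in E(\Gamma)\setminus T$. The relations are: $a_{\iota(e)}^{\psi(\overline e)}=a_{\tau(e)}^{\psi(e)}$ for $e\in T$; and $t_{\overline e}=t_e^{-1}$ and $a_{\iota(e)}^{\psi(\overline e)}t_e=t_e a_{\tau(e)}^{\psi(e)}$ for $e\in E(\Gamma)\setminus T$. The isomorphism type does not depend on $T$. Fully reduced: a connected $(\Gamma,\psi)$ is fully reduced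 if there are no distinct vertices $v,u$ such that, in its GBS group, $a_v$ is conjugate to a power of $a_u$ (this does not depend on $T$). Set of primes: $\mathcal{P}(\Gamma,\psi)$ is the set of primes $r$ with $r\mid\psi(e)$ for some $e\in E(\Gamma)$. Minimal edge: $e\in E(\Gamma)$ is minimal if there is no $e'\in E(\Gamma)$ with $\tau(e')=\tau(e)$, $\psi(e')\mid\psi(e)$ and $\psi(e')\neq\pm\psi(e)$. Flexible: a connected $(\Gamma,\psi)$ is flexible if (1) it is fully reduced; (2) there is no $e\in E(\Gamma)$ such that both $e$ and $\overline e$ are minimal; (3) for every two distinct edges $e,e'\in E(\Gamma)$ with $\tau(e)=\tau(e')$, if $\psi(e)\mid\psi(e')$ then $\psi(e')/\psi(e)$ is a multiple of every prime in $\mathcal{P}(\Gamma,\psi)$. Random GBS graph with parameters $V,E,D,N$: fix a set $\{p_1,\dots,p_D\}$ of $D$ distinct primes (which one is irrelevant for flexibility). The vertex set is $[V]=\{1,\dots,V\}$. Let $v_1,\dots,v_{2E}$ be independent and uniform in $[V]$; the $E$ topological edges join $v_{2i-1}$ to $v_{2i}$, $i=1,\dots,E$ (a loop if these coincide). Independently of the graph, each of the $2E$ oriented edges $e_i$ receives the label $\psi(e_i)=(-1)^{\epsilon_i}\prod_{j=1}^D p_j^{\alpha_{i,j}}$, where all $\epsilon_i$ and $\alpha_{i,j}$ are independent, $\epsilon_i$ is uniform in $\{0,1\}$ and $\alpha_{i,j}$ is uniform in $\{0,1,\dots,N-1\}$. *)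

(* Defs.v *)
From HB Require Import structures.
From mathcomp Require Import all_boot all_order all_algebra.
From mathcomp Require Import boolp reals.

Set Implicit Arguments.
Unset Strict Implicit.
Unset Printing Implicit Defensive.

Import Order.TTheory GRing.Theory Num.Theory.

Local Open Scope quotient_scope.

(** * Group presentations

    A word is a sequence of letters [(x, b)], where [(x, false)] stands for the
    generator [x] and [(x, true)] for its formal inverse.  A relation is an
    equation between two words. *)

Definition word (X : choiceType) := seq (X * bool).

Definition word_inv (X : choiceType) (w : word X) : word X :=
  rev [seq (l.1, ~~ l.2) | l <- w].

Inductive pres_eq (X : choiceType) (rels : word X -> word X -> Prop) :
    word X -> word X -> Prop :=
| PresRefl w : pres_eq rels w w
| PresSym w1 w2 : pres_eq rels w1 w2 -> pres_eq rels w2 w1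
| PresTrans w1 w2 w3 :
    pres_eq rels w1 w2 -> pres_eq rels w2 w3 -> pres_eq rels w1 w3
| PresCat w1 w2 w3 w4 :
    pres_eq rels w1 w2 -> pres_eq rels w3 w4 ->
    pres_eq rels (w1 ++ w3) (w2 ++ w4)
| PresCancel x b : pres_eq rels [:: (x, b); (x, ~~ b)] [::]
| PresRel w1 w2 : rels w1 w2 -> pres_eq rels w1 w2.

Section PresentedGroup.
Variables (X : choiceType) (rels : word X -> word X -> Prop).

Definition pres_eqb : rel (word X) := fun w1 w2 => `[< pres_eq rels w1 w2 >].

Lemma pres_eqb_refl : reflexive pres_eqb.
Proof. by move=> w; apply/asboolP; apply: PresRefl. Qed.

Lemma pres_eqb_sym : symmetric pres_eqb.
Proof. by move=> w1 w2; apply/asboolP/asboolP; apply: PresSym. Qed.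

Lemma pres_eqb_trans : transitive pres_eqb.
Proof.
move=> w2 w1 w3 /asboolP h12 /asboolP h23; apply/asboolP.
exact: PresTrans h12 h23.
Qed.

Canonical pres_eqb_equiv :=
  EquivRel pres_eqb pres_eqb_refl pres_eqb_sym pres_eqb_trans.

Definition presented_group := {eq_quot pres_eqb}.

HB.instance Definition _ :=
  Choice.copy presented_group {eq_quot pres_eqb}.
HB.instance Definition _ :=
  Quotient.copy presented_group {eq_quot pres_eqb}.

Definition pres_class (w : word X) : presented_group :=
  \pi_presented_group w.

Lemma pres_classP (w1 w2 : word X) :
  pres_class w1 = pres_class w2 <-> pres_eq rels w1 w2.
Proof.
split=> [h|h]; first by move/eqmodP/asboolP: h.
by apply/eqmodP; apply/asboolP.
Qed.

Lemma pres_repr (w : word X) : pres_eq rels (repr (pres_class w)) w.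
Proof. by apply/pres_classP; rewrite /pres_class reprK. Qed.

Lemma word_invK : involutive (@word_inv X).
Proof.
move=> w; rewrite /word_inv map_rev revK -map_comp.
by rewrite map_id_in // => -[x b] _ /=; rewrite negbK.
Qed.

Lemma pres_eq_mulwV (w : word X) : pres_eq rels (w ++ word_inv w) [::].
Proof.
elim: w => [|[x b] w IH]; first exact: PresRefl.
rewrite /word_inv /= rev_cons -cats1 -/(word_inv w).
apply: PresTrans (PresCancel rels x b).
rewrite -cat1s -[[:: (x, b); _]]cat1s catA.
apply: (@PresCat _ _ [:: (x, b)] [:: (x, b)]); first exact: PresRefl.
rewrite -/(cat _ _) catA; exact: PresCat IH (PresRefl _ [:: (x, ~~ b)]).
Qed.

Lemma pres_eq_mulVw (w : word X) : pres_eq rels (word_inv w ++ w) [::].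
Proof. by rewrite -{2}[w]word_invK; apply: pres_eq_mulwV. Qed.

Lemma pres_eq_inv (w1 w2 : word X) :
  pres_eq rels w1 w2 -> pres_eq rels (word_inv w1) (word_inv w2).
Proof.
move=> h; have r w : pres_eq rels w w by apply: PresRefl.
apply: (@PresTrans _ _ _ (word_inv w1 ++ (w2 ++ word_inv w2))).
  rewrite -{1}[word_inv w1]cats0; apply: PresCat (r _) _.
  exact: PresSym (pres_eq_mulwV _).
rewrite catA -[word_inv w2 in X in pres_eq _ _ X]cat0s.
apply: PresCat (r _); apply: PresTrans (pres_eq_mulVw w1).
by apply: PresCat (r _) _; apply: PresSym.
Qed.

Definition pres_one : presented_group := pres_class [::].
Definition pres_mul (g h : presented_group) : presented_group :=
  pres_class (repr g ++ repr h).
Definition pres_inv (g : presented_group) : presented_group :=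
  pres_class (word_inv (repr g)).

Lemma pres_class_surj (g : presented_group) : exists w, g = pres_class w.
Proof. by exists (repr g); rewrite /pres_class reprK. Qed.

Lemma pres_mul_class (w1 w2 : word X) :
  pres_mul (pres_class w1) (pres_class w2) = pres_class (w1 ++ w2).
Proof. by apply/pres_classP; apply: PresCat; apply: pres_repr. Qed.

Lemma pres_inv_class (w : word X) :
  pres_inv (pres_class w) = pres_class (word_inv w).
Proof. by apply/pres_classP; apply/pres_eq_inv/pres_repr. Qed.

Lemma pres_mulgA : associative pres_mul.
Proof.
move=> f g h; have [u ->] := pres_class_surj f.
have [v ->] := pres_class_surj g; have [w ->] := pres_class_surj h.
by rewrite (pres_mul_class v w) (pres_mul_class u v) !pres_mul_class catA.
Qed.

Lemma pres_mul1g : left_id pres_one pres_mul.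
Proof.
by move=> g; have [w ->] := pres_class_surj g; rewrite pres_mul_class.
Qed.

Lemma pres_mulg1 : right_id pres_one pres_mul.
Proof.
by move=> g; have [w ->] := pres_class_surj g; rewrite pres_mul_class cats0.
Qed.

Lemma pres_mulVg : left_inverse pres_one pres_inv pres_mul.
Proof.
move=> g; have [w ->] := pres_class_surj g.
rewrite (pres_inv_class w) pres_mul_class.
by apply/pres_classP; apply: pres_eq_mulVw.
Qed.

Lemma pres_mulgV : right_inverse pres_one pres_inv pres_mul.
Proof.
move=> g; have [w ->] := pres_class_surj g.
rewrite (pres_inv_class w) pres_mul_class.
by apply/pres_classP; apply: pres_eq_mulwV.
Qed.

HB.instance Definition _ := isGroup.Build presented_group
  pres_mulgA pres_mul1g pres_mulg1 pres_mulVg pres_mulgV.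

Definition pres_gen (x : X) : presented_group := pres_class [:: (x, false)].

End PresentedGroup.

Definition word_expz (X : choiceType) (x : X) (k : int) : word X :=
  nseq `|k|%N (x, (k < 0)%R).

Definition expgz (G : groupType) (g : G) (k : int) : G :=
  match k with
  | Posz n => (g ^+ n)%g
  | Negz n => (g ^- n.+1)%g
  end.

(** * GBS graphs *)

Record graph := Graph {
  vertex : finType;
  edge : finType;
  bar : edge -> edge;
  bar_neq : forall e, bar e != e;
  barK : involutive bar;
  init : edge -> vertex
}.

Definition term (G : graph) (e : edge G) : vertex G := init (bar e).

Record gbs_graph := GbsGraph {
  gbs_base :> graph;
  label : edge gbs_base -> int;
  label_neq0 : forall e, label e != 0%R
}.

Definition joined (G : graph) (T : {set edge G}) : rel (vertex G) :=
  [rel u v | [exists e in T, (init e == u) && (term e == v)]].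

Definition connected (G : graph) : Prop :=
  forall u v : vertex G, connect (joined [set: edge G]) u v.

(** Simple closed edge path; the condition on [bar] excludes [e, bar e] as a
    circuit of length 2, and a loop is a circuit of length 1. *)
Definition circuit (G : graph) (s : seq (edge G)) : bool :=
  [&& s != [::],
      cycle [rel e f | (term e == init f) && (f != bar e)] s
    & uniq [seq init e | e <- s]].

(** A subtree is given by its set of edges; [set0] is the one-vertex tree. *)
Definition is_tree (G : graph) (T : {set edge G}) : Prop :=
  [/\ {in T, forall e, bar e \in T},
      {in T &, forall e f, connect (joined T) (init e) (init f)}
    & forall s : seq (edge G), {subset s <= T} -> ~~ circuit s].

Definition maximal_tree (G : graph) (T : {set edge G}) : Prop :=
  is_tree T /\
  forall T' : {set edge G}, is_tree T' -> T \subset T' -> T' = T.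

(** Generators: [inl v] is a_v, and [inr e] is t_e for e outside T. *)
Definition gbs_gen (G : gbs_graph) (T : {set edge G}) : choiceType :=
  (vertex G + {e : edge G | e \notin T})%type.

Inductive gbs_rel (G : gbs_graph) (T : {set edge G}) :
    word (gbs_gen T) -> word (gbs_gen T) -> Prop :=
| GbsTree (e : edge G) : e \in T ->
    gbs_rel (word_expz (inl (init e) : gbs_gen T) (label (bar e)))
            (word_expz (inl (term e) : gbs_gen T) (label e))
| GbsBar (e f : {e : edge G | e \notin T}) : val f = bar (val e) ->
    gbs_rel [:: (inr f : gbs_gen T, false)] [:: (inr e : gbs_gen T, true)]
| GbsStable (e : {e : edge G | e \notin T}) :
    gbs_rel (word_expz (inl (init (val e)) : gbs_gen T) (label (bar (val e)))
               ++ [:: (inr e : gbs_gen T, false)])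
            ([:: (inr e : gbs_gen T, false)]
               ++ word_expz (inl (term (val e)) : gbs_gen T) (label (val e))).

Definition gbs_group (G : gbs_graph) (T : {set edge G}) : groupType :=
  presented_group (@gbs_rel G T).

Definition vertex_gen (G : gbs_graph) (T : {set edge G}) (v : vertex G) :
  gbs_group T := pres_gen (@gbs_rel G T) (inl v).

(** The condition on the group does not depend on the maximal tree; the
    quantification over T is never void since maximal trees always exist. *)
Definition fully_reduced (G : gbs_graph) : Prop :=
  forall T : {set edge G}, maximal_tree T ->
  ~ exists v u : vertex G, v != u /\
      exists (g : gbs_group T) (k : int),
        (vertex_gen T v ^ g)%g = expgz (vertex_gen T u) k.

Definition gbs_prime (G : gbs_graph) (r : nat) : Prop :=
  prime r /\ exists e : edge G, (r%:Z %| label e)%Z.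

Definition minimal_edge (G : gbs_graph) (e : edge G) : Prop :=
  ~ exists e' : edge G,
      [/\ term e' = term e, (label e' %| label e)%Z,
          label e' <> label e & label e' <> (- label e)%R].

(** Meaningful for connected G only. *)
Definition flexible (G : gbs_graph) : Prop :=
  [/\ fully_reduced G,
      ~ (exists e : edge G, minimal_edge e /\ minimal_edge (bar e))
    & forall e e' : edge G, e <> e' -> term e = term e' ->
        (label e %| label e')%Z ->
        forall r : nat, gbs_prime G r ->
          (r%:Z %| (label e' %/ label e)%Z)%Z].

(** * Random GBS graphs *)

Section RandomGbsGraph.
Variables V E D N : nat.

(** The topological edge i consists of the oriented edges [(i, false)] and
    [(i, true)]. *)
Definition random_edge : finType := ('I_E * bool)%type.

(** An outcome gives the initial vertices, the sign bits and the exponents of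
    all oriented edges.  The uniform law on this product is the one for which
    all these coordinates are independent and uniform. *)
Definition outcome : finType :=
  ({ffun random_edge -> 'I_V} * {ffun random_edge -> bool} *
   {ffun random_edge * 'I_D -> 'I_N})%type.

Definition random_bar (e : random_edge) : random_edge := (e.1, ~~ e.2).

Lemma random_bar_neq e : random_bar e != e.
Proof. by case: e => i b; rewrite /random_bar xpair_eqE eqxx /=; case: b. Qed.

Lemma random_barK : involutive random_bar.
Proof. by case=> i b; rewrite /random_bar negbK. Qed.

Definition random_graph (w : outcome) : graph :=
  Graph random_bar_neq random_barK w.1.1.

Variables (p : 'I_D -> nat) (p_prime : forall j, prime (p j)).

Definition random_label (w : outcome) (e : random_edge) : int :=
  ((-1) ^+ (w.1.2 e : nat) * \prod_(j < D) (p j)%:Z ^+ (w.2 (e, j) : nat))%R.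

Lemma random_label_neq0 w e : random_label w e != 0%R.
Proof.
rewrite mulf_neq0 ?signr_eq0 //; apply/prodf_neq0 => j _.
by rewrite expf_neq0 // eqz_nat -lt0n prime_gt0.
Qed.

Definition random_gbs_graph (w : outcome) : gbs_graph :=
  @GbsGraph (random_graph w) (random_label w) (random_label_neq0 w).

End RandomGbsGraph.

Definition uniform_prob (R : realType) (T : finType) (A : T -> Prop) : R :=
  (#|[pred x | `[< A x >]]|%:R / #|T|%:R)%R.

(* Main.v *)
Require Import Defs.
From mathcomp Require Import all_boot all_order all_algebra.
From mathcomp Require Import boolp reals sequences exp.
From mathcomp Require Import ring lra.

(** Four events of small probability are excluded.

    - Two oriented edges agree in some exponent, or some exponent of p_0
      vanishes.  Each coincidence has probability 1/N, and N >= E^4.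
      Otherwise divisibility of labels is a coordinatewise comparison that is
      strict everywhere, and p_0 divides every label.  In the second case the
      GBS group maps to the sum of one copy of Z/p_0 per vertex, by a_v |-> e_v
      and t_e |-> 0, so no a_v is conjugate to a power of a_u with u <> v: the
      graph is fully reduced, without any Bass-Serre theory.
    - Some pair (u, v) of vertices is joined by no topological edge in the
      direction u -> v: probability at most V^2 exp (- E / V^2).
    - For some topological edge i, neither orientation (i, b) is dominated by
      an edge (i', b), i' <> i, with the same terminal vertex and smaller
      exponents.  Comparing (i, b) only with edges of the same orientation bit
      b makes the events for b = false and b = true independent, even when i
      is a loop, so the probability is q^2 with
        q = E_x (1 - F(x) / V)^(E-1),  F(x) = prod_k (x_k + 1) / N.
      As exp (- t) <= t^(- s) for 0 <= s <= 1 and the mean of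
      ((a + 1) / N)^(- s) over a < N is at most 1 / (1 - s),
        q <= ((E-1) / V)^(- s) (1 - s)^(- D),
      and s = 1 - eps / 8 gives E q^2 <= E^(- eps / 8) / 4. *)

Set Implicit Arguments.
Unset Strict Implicit.
Unset Printing Implicit Defensive.

Import Order.TTheory GRing.Theory Num.Theory.
Local Open Scope ring_scope.

(** * Exponent sums modulo a common divisor of the labels *)

Section ExponentSum.
Variables (G : gbs_graph) (r : nat) (r_gt1 : (1 < r)%N).
Hypothesis r_dvd : forall e : edge G, (r%:Z %| label e)%Z.
Variables (T : {set edge G}) (v : vertex G).

(** The homomorphism to Z/r sending a_v to 1 and every other generator to 0, read on words. *)
Definition exp_sum (w : word (gbs_gen T)) : 'Z_r :=
  \sum_(l <- w) (if l.1 == inl v then (-1) ^+ (l.2 : nat) else 0).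

Lemma exp_sum_cat w1 w2 : exp_sum (w1 ++ w2) = exp_sum w1 + exp_sum w2.
Proof. by rewrite /exp_sum big_cat. Qed.

Lemma exp_sum_expz x (e : edge G) : exp_sum (word_expz x (label e)) = 0.
Proof.
rewrite /exp_sum /word_expz big_nseq iter_addr addr0.
have /dvdnP[q ->] : (r %| `|label e|)%N by rewrite -(absz_nat r) -dvdzE r_dvd.
by rewrite mulrnA -[X in X = _]mulr_natr pchar_Zp // mulr0.
Qed.

(** Powers given by labels vanish modulo [r] and stable letters have weight 0, so both sides of
    every defining relation have sum 0. *)
Lemma exp_sum_eq w1 w2 : pres_eq (@gbs_rel G T) w1 w2 -> exp_sum w1 = exp_sum w2.
Proof.
elim=> {w1 w2} //.
- by move=> w1 w2 w3 _ -> _ ->.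
- by move=> w1 w2 w3 w4 _ h1 _ h2; rewrite !exp_sum_cat h1 h2.
- move=> x b; rewrite /exp_sum !big_cons big_nil /=.
  by case: ifP => // _; [case: b; rewrite ?addr0 ?addNr ?subrr | rewrite !addr0].
move=> w1 w2; case=> [e _|e f _|e].
- by rewrite !exp_sum_expz.
- by rewrite /exp_sum !big_cons !big_nil.
by rewrite !exp_sum_cat !exp_sum_expz addr0 add0r.
Qed.

Definition exp_sum_class (g : gbs_group T) : 'Z_r := exp_sum (repr g).

Lemma exp_sum_classE w : exp_sum_class (pres_class _ w) = exp_sum w.
Proof. exact: exp_sum_eq (pres_repr _ w). Qed.

Lemma exp_sum_classM (g h : gbs_group T) :
  exp_sum_class (g * h)%g = exp_sum_class g + exp_sum_class h.
Proof. by rewrite /mul /= /pres_mul exp_sum_classE exp_sum_cat. Qed.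

Lemma exp_sum_class1 : exp_sum_class 1%g = 0.
Proof. by apply: (addrI (exp_sum_class 1%g)); rewrite -exp_sum_classM mulg1 addr0. Qed.

Lemma exp_sum_classV (g : gbs_group T) :
  exp_sum_class g^-1%g = - exp_sum_class g.
Proof.
by apply: (addrI (exp_sum_class g)); rewrite -exp_sum_classM mulgV exp_sum_class1 subrr.
Qed.

Lemma exp_sum_classX (g : gbs_group T) n :
  exp_sum_class (g ^+ n)%g = exp_sum_class g *+ n.
Proof.
elim: n => [|n IH]; first by rewrite expg0 exp_sum_class1.
by rewrite expgS exp_sum_classM IH mulrS.
Qed.

Lemma exp_sum_vertex_gen u : exp_sum_class (vertex_gen T u) = (u == v)%:R.
Proof.
rewrite /vertex_gen /pres_gen exp_sum_classE /exp_sum big_cons big_nil /= addr0.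
by rewrite (inj_eq (@inl_inj _ _)); case: eqP.
Qed.

(** ['Z_r] is abelian, so conjugation preserves the exponent sum of a_v, which is 1, while every
    power of a_u has sum 0. *)
Lemma vertex_gen_not_conj u : v != u -> forall (g : gbs_group T) (k : int),
  (vertex_gen T v ^ g)%g <> expgz (vertex_gen T u) k.
Proof.
move=> vu g k /(congr1 exp_sum_class).
rewrite conjgE !exp_sum_classM exp_sum_classV addrCA addNr addr0.
rewrite exp_sum_vertex_gen eqxx.
case: k => n /=; rewrite ?exp_sum_classV exp_sum_classX exp_sum_vertex_gen;
  rewrite eq_sym (negPf vu) mul0rn ?oppr0 => /eqP; by rewrite oner_eq0.
Qed.

End ExponentSum.

Lemma common_divisor_fully_reduced (G : gbs_graph) (r : nat) :
  (1 < r)%N -> (forall e : edge G, (r%:Z %| label e)%Z) -> fully_reduced G.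
Proof.
by move=> r1 hr T _ [v [u [vu [g [k]]]]]; apply: (vertex_gen_not_conj r1 hr vu).
Qed.

(** * Divisibility of labels and flexibility of a good outcome *)

Section Labels.
Variables (V E D N : nat) (p : 'I_D -> nat).
Hypotheses (p_prime : forall j, prime (p j)) (p_inj : injective p).
Variable w : outcome V E D N.

Lemma absz_random_label e :
  `|random_label p w e|%N = (\prod_(j < D) p j ^ w.2 (e, j))%N.
Proof.
rewrite /random_label abszMsign.
rewrite (big_morph absz abszM (absz_nat 1)).
by apply: eq_bigr => j _; rewrite abszX.
Qed.

(** As [p] is injective, the other prime powers are coprime to [p j]. *)
Lemma logn_random_label e j :
  logn (p j) `|random_label p w e|%N = w.2 (e, j).
Proof.
rewrite absz_random_label.
have -> : (\prod_(k < D) p k ^ w.2 (e, k))%N =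
   (p j ^ w.2 (e, j) * \prod_(k < D | k != j) p k ^ w.2 (e, k))%N.
  by rewrite (bigD1 j).
have p_gt0 k : (0 < p k ^ w.2 (e, k))%N by rewrite expn_gt0 prime_gt0.
rewrite lognM ?prodn_gt0 // lognX (logn_prime _ (p_prime j)) eqxx muln1.
rewrite logn_coprime ?addn0 //; apply: (big_ind (coprime (p j))).
- exact: coprimen1.
- by move=> x y cx cy; rewrite coprimeMr cx cy.
move=> k kj; rewrite coprimeXr // prime_coprime // dvdn_prime2 //.
by apply: contra kj => /eqP /p_inj ->.
Qed.

Lemma random_label_dvd e f :
  (random_label p w e %| random_label p w f)%Z = [forall j, w.2 (e, j) <= w.2 (f, j)]%N.
Proof.
rewrite dvdzE; apply/idP/forallP => [ef j|ef].
  rewrite -!logn_random_label; apply: dvdn_leq_log ef.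
  by rewrite absz_gt0 random_label_neq0.
rewrite !absz_random_label; elim/big_rec2: _ => // j x y _.
by apply: dvdn_mul; rewrite dvdn_exp2l.
Qed.

Lemma random_gbs_prime r :
  gbs_prime (random_gbs_graph p_prime w) r -> exists j, r = p j.
Proof.
case=> r_pr [e] /=; rewrite dvdzE absz_random_label /=.
elim/big_rec: _ => [|j x _ IH]; first by rewrite dvdn1 => /eqP r1; rewrite r1 in r_pr.
rewrite Euclid_dvdM // => /orP[|//]; case: (w.2 (e, j) : nat) => [|n].
  by rewrite expn0 dvdn1 => /eqP r1; rewrite r1 in r_pr.
by rewrite Euclid_dvdX // dvdn_prime2 // => /andP[/eqP-> _]; exists j.
Qed.

Definition distinct_exponents : Prop :=
  forall e f : random_edge E, e <> f -> forall j, w.2 (e, j) != w.2 (f, j).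

(** Only one direction of each edge counts, so a given edge joins a given pair with probability
    exactly 1/V^2. *)
Definition all_joined : Prop :=
  forall u v : 'I_V, exists i : 'I_E, w.1.1 (i, false) = u /\ w.1.1 (i, true) = v.

(** [w.1.1 (i, ~~ b)] is the terminal vertex of [(i, b)]. *)
Definition dominated (i : 'I_E) (b : bool) : Prop :=
  exists2 i', i' != i & w.1.1 (i', ~~ b) = w.1.1 (i, ~~ b) /\
    forall j, (w.2 ((i', b), j) <= w.2 ((i, b), j))%N.

Lemma all_joined_connected : all_joined -> connected (random_gbs_graph p_prime w).
Proof.
move=> h u v; apply: connect1; have [i [hu hv]] := h u v.
by apply/existsP; exists (i, false); rewrite inE /= hu /term /= hv !eqxx.
Qed.

(** Divisibility compares the exponents of each prime and distinctness makes the comparison strict,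
    so each [p j] survives in the quotient. *)
Lemma distinct_exponents_quotient :
  distinct_exponents ->
  forall e e' : edge (random_gbs_graph p_prime w), e <> e' ->
  (label e %| label e')%Z ->
  forall r, gbs_prime (random_gbs_graph p_prime w) r ->
    (r%:Z %| (label e' %/ label e)%Z)%Z.
Proof.
move=> hd e e' ne dv r /random_gbs_prime[j ->].
have := dv; rewrite [in X in X -> _]random_label_dvd => /forallP/(_ j) le_ee'.
have lt_ee' : (w.2 (e, j) < w.2 (e', j))%N by rewrite ltn_neqAle hd.
case/dvdzP: dv => q e'E; rewrite e'E mulzK ?label_neq0 // dvdzE /=.
have q0 : q != 0.
  by apply/eqP => q0; have := label_neq0 e'; rewrite e'E q0 mul0r eqxx.
move: lt_ee'; rewrite -!logn_random_label -[random_label p w e']/(label e') e'E.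
rewrite abszM lognM ?absz_gt0 ?random_label_neq0 //.
rewrite -[X in (X < _)%N]add0n ltn_add2r logn_gt0 mem_primes.
by case/and3P.
Qed.

(** Valuations ignore signs, so differing exponents of a single prime exclude both equality and
    opposite signs. *)
Lemma dominated_not_minimal i b :
  (0 < D)%N -> distinct_exponents -> dominated i b ->
  ~ minimal_edge ((i, b) : edge (random_gbs_graph p_prime w)).
Proof.
move=> D_gt0 hd [i' ne [ht hle]]; apply.
have neq : ((i', b) : random_edge E) <> (i, b) by case=> /eqP; rewrite (negPf ne).
have := hd _ _ neq (Ordinal D_gt0); rewrite -val_eqE /= -!logn_random_label => hl.
exists (i', b); split; first by rewrite /term /= /random_bar /= ht.
- by rewrite random_label_dvd; apply/forallP.
- by move=> /= h; rewrite h eqxx in hl.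
- by move=> /= h; rewrite h abszN eqxx in hl.
Qed.

Lemma good_outcome :
  (0 < D)%N -> distinct_exponents -> all_joined ->
  (forall i, exists b, dominated i b) ->
  (exists j, forall e, w.2 (e, j) != 0 :> nat) ->
  connected (random_gbs_graph p_prime w) /\ flexible (random_gbs_graph p_prime w).
Proof.
move=> D_gt0 hd hj hdom [j hj0]; split; first exact: all_joined_connected.
split.
- apply: (@common_divisor_fully_reduced _ (p j)); first exact: prime_gt1.
  move=> e; have := hj0 e; rewrite dvdzE -logn_random_label -lt0n logn_gt0.
  by rewrite mem_primes => /and3P[].
(* The bit [c] is either [b] or its negation, so [(i, b)], which is not minimal, is the given edge
   or its reverse. *)
- case=> -[i c] []; have [b hb] := hdom i.
  move: (dominated_not_minimal D_gt0 hd hb).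
  by case: (eqVneq b c) => [->|] // bc nm _; case: b c bc nm {hb} => -[].
by move=> e e' ne _; exact: distinct_exponents_quotient.
Qed.

End Labels.

(** * Expectations under uniform laws and independence *)

Section Mean.
Variable R : realType.
Implicit Types S T U I : finType.

Definition mean T (f : T -> R) : R := (\sum_x f x) / #|T|%:R.

Lemma eq_mean T (f g : T -> R) : f =1 g -> mean f = mean g.
Proof. by move=> fg; congr (_ / _); apply: eq_bigr => x _. Qed.

Lemma ler_mean T (f g : T -> R) : (forall x, f x <= g x) -> mean f <= mean g.
Proof. by move=> fg; rewrite ler_wpM2r ?invr_ge0 //; apply: ler_sum. Qed.

Lemma mean_ge0 T (f : T -> R) : (forall x, 0 <= f x) -> 0 <= mean f.
Proof. by move=> f0; rewrite divr_ge0 ?sumr_ge0. Qed.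

Lemma mean_const T (c : R) : (0 < #|T|)%N -> mean (fun _ : T => c) = c.
Proof.
move=> T0; rewrite /mean sumr_const -[X in X / _]mulr_natr mulfK //.
by rewrite pnatr_eq0 -lt0n.
Qed.

Lemma mean1B T (f : T -> R) : (0 < #|T|)%N -> mean (fun x => 1 - f x) = 1 - mean f.
Proof.
by move=> T0; rewrite -[in RHS](mean_const 1 T0) /mean -mulrBl sumrB.
Qed.

Lemma mean_indicator1 T (a : T) : mean (fun x => (x == a)%:R) = #|T|%:R^-1.
Proof.
rewrite /mean (bigD1 a) //= eqxx big1 ?addr0 ?mul1r // => x /negPf -> //.
Qed.

Lemma mean_pair S T (f : S -> R) (g : T -> R) :
  mean (fun x : S * T => f x.1 * g x.2) = mean f * mean g.
Proof.
rewrite /mean card_prod natrM invfM mulrACA; congr (_ * _).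
rewrite big_distrl /= -(pair_big xpredT xpredT (fun a b => f a * g b)) /=.
by apply: eq_bigr => a _; rewrite mulr_sumr.
Qed.

(** Independence of the coordinates, by distributing the product over the sums. *)
Lemma mean_ffun_prod I S (g : I -> S -> R) :
  mean (fun x : {ffun I -> S} => \prod_i g i (x i)) = \prod_i mean (g i).
Proof.
rewrite /mean -bigA_distr_bigA /= big_split /= prodr_const card_ffun.
by rewrite exprVn -natrX.
Qed.

(* Conditioning on the value [u] of the coordinate [i0]. *)
Lemma mean_ffun_condition I S (i0 : I) (g : S -> S -> R) :
  mean (fun x : {ffun I -> S} => \prod_(i | i != i0) g (x i) (x i0)) =
  mean (fun u : S => mean (g ^~ u) ^+ #|I|.-1).
Proof.
(* For fixed [u] the factor at [i0] is the indicator of the value [u], so the integrand is a full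
   product over coordinates; the mean of this indicator supplies the weight of the outer average. *)
pose h (u : S) (i : I) (y : S) : R := if i == i0 then (y == u)%:R else g y u.
have hE (x : {ffun I -> S}) :
    \prod_(i | i != i0) g (x i) (x i0) = \sum_u \prod_i h u i (x i).
  rewrite (bigD1 (x i0)) //= [X in _ + X]big1 ?addr0.
    rewrite [RHS](bigD1 i0) //= {1}/h !eqxx mul1r.
    by apply: eq_bigr => i ne; rewrite /h (negPf ne).
  by move=> u ne; rewrite (bigD1 i0) //= /h eqxx eq_sym (negPf ne) mul0r.
rewrite (eq_mean hE) {1}/mean exchange_big /= mulr_suml.
rewrite [RHS]/mean mulr_suml; apply: eq_bigr => u _.
rewrite -[LHS]/(mean (fun x : {ffun I -> S} => \prod_i h u i (x i))).
rewrite mean_ffun_prod (bigD1 i0) //= mulrC; congr (_ * _).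
  rewrite (eq_bigr (fun _ => mean (g ^~ u))).
    by rewrite prodr_const cardC1.
  by move=> i ne; apply: eq_mean => y; rewrite /h (negPf ne).
rewrite -(mean_indicator1 u); apply: eq_mean => y.
by rewrite /h eqxx.
Qed.

Lemma natr_forall I (b : I -> bool) :
  ([forall i, b i])%:R = \prod_i (b i)%:R :> R.
Proof.
have [/forallP h|/forallPn[i /negPf bi]] := boolP [forall i, b i].
  by rewrite big1 // => i _; rewrite h.
by rewrite (bigD1 i) //= bi mul0r.
Qed.

Lemma natr_forall_in I (P : pred I) (b : I -> bool) :
  ([forall (i | P i), b i])%:R = \prod_(i | P i) (b i)%:R :> R.
Proof.
have [/forall_inP h|/forall_inPn[i Pi /negPf bi]] := boolP [forall (i | P i), b i].
  by rewrite big1 // => i /h ->.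
by rewrite (bigD1 i) //= bi mul0r.
Qed.

End Mean.

(** * Uniform probability, union bound and counting *)

Section UniformProb.
Variable R : realType.
Implicit Types T U I : finType.
Local Notation P := (uniform_prob R).

Lemma uniform_probE T (A : T -> Prop) : P A = mean (fun x => `[< A x >]%:R).
Proof.
rewrite /uniform_prob /mean -sum1_card natr_sum big_mkcond /=; congr (_ / _).
by apply: eq_bigr => x _; rewrite inE; case: `[< A x >].
Qed.

Lemma uniform_prob_le T (A B : T -> Prop) :
  (forall x, A x -> B x) -> P A <= P B.
Proof.
move=> AB; rewrite ler_wpM2r ?invr_ge0 // ler_nat subset_leq_card //.
by apply/subsetP => x; rewrite !inE => /asboolP/AB/asboolP.
Qed.

Lemma uniform_probC T (A : T -> Prop) : (0 < #|T|)%N -> 1 - P (fun x => ~ A x) = P A.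
Proof.
move=> T0; apply/eqP; rewrite subr_eq -mulrDl -natrD.
rewrite -(cardC [pred x | `[< A x >]]) in T0 *.
rewrite [X in (_ + X)%N](_ : _ = #|[predC [pred x | `[< A x >]]]|).
  by rewrite divff // pnatr_eq0 -lt0n.
by apply: eq_card => x; rewrite !inE asbool_neg.
Qed.

Lemma uniform_prob_or T (A B : T -> Prop) : P (fun x => A x \/ B x) <= P A + P B.
Proof.
rewrite -mulrDl ler_wpM2r ?invr_ge0 // -natrD ler_nat.
rewrite -cardUI; apply: leq_trans (leq_addr _ _).
apply: subset_leq_card; apply/subsetP => x; rewrite !inE.
by move=> /asboolP [/asboolP ->|/asboolP ->]; rewrite ?orbT.
Qed.

Lemma uniform_prob_exists T I (A : I -> T -> Prop) (c : R) :
  (forall i, P (A i) <= c) -> P (fun x => exists i, A i x) <= #|{: I}|%:R * c.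
Proof.
move=> Ac; apply: (@le_trans _ _ (\sum_i P (A i))); last first.
  by rewrite mulr_natl -sumr_const; apply: ler_sum.
rewrite uniform_probE /mean (eq_bigr _ (fun i _ => uniform_probE (A i))) /mean.
rewrite -mulr_suml exchange_big /= ler_wpM2r ?invr_ge0 //; apply: ler_sum => x _.
case: asboolP => [[i Aix]|_]; last by rewrite sumr_ge0.
by rewrite (bigD1 i) //= asboolT // lerDl sumr_ge0.
Qed.

(** An injection between types of equal size is a bijection, so it preserves the uniform law. *)
Lemma uniform_prob_preim T U (f : T -> U) (A : U -> Prop) :
  injective f -> #|T| = #|U| -> P (fun x => A (f x)) <= P A.
Proof.
move=> f_inj TU; rewrite /uniform_prob TU ler_wpM2r ?invr_ge0 // ler_nat.
rewrite -(card_image f_inj) subset_leq_card //; apply/subsetP => _ /imageP[x + ->].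
by rewrite !inE.
Qed.

(** Injectivity gives |A| |U| <= |T|. In the applications [g] overwrites a coordinate that the event
    determines from the others. *)
Lemma uniform_prob_injective T U (A : T -> Prop) (g : T * U -> T) :
  (0 < #|U|)%N -> {in [pred z | `[< A z.1 >]] &, injective g} ->
  P A <= #|U|%:R^-1.
Proof.
move=> U0 g_inj; have [T0|T0] := posnP #|T|.
  by rewrite /uniform_prob T0 invr0 mulr0 invr_ge0.
rewrite ler_pdivrMr ?ltr0n // ler_pdivlMl ?ltr0n // -natrM ler_nat mulnC -cardX.
rewrite -(card_in_image (f := g)) ?max_card // => x y xA yA.
by apply: g_inj; rewrite !inE in xA yA *; case/andP: xA; case/andP: yA.
Qed.

End UniformProb.

(** * Probabilities of the bad events *)

Section BadEvents.
Variables (R : realType) (V E D N : nat).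
Local Notation P := (uniform_prob R).
Local Notation outcome := (outcome V E D N).

Definition set_exponent (z : outcome * 'I_N) (e : random_edge E) (j : 'I_D) : outcome :=
  (z.1.1, [ffun ek => if ek == (e, j) then z.2 else z.1.2 ek]).

(** The new value is read off at [(e, j)], and the overwritten one is recovered because [A]
    determines it from the other exponents. *)
Lemma set_exponent_inj e j (A : outcome -> Prop) :
  (forall w w', A w -> A w' -> (forall ek, ek != (e, j) -> w.2 ek = w'.2 ek) ->
     w.2 (e, j) = w'.2 (e, j)) ->
  {in [pred z | `[< A z.1 >]] &, injective (fun z => set_exponent z e j)}.
Proof.
move=> hA [[w1 w2] c] [[w1' w2'] c']; rewrite !inE /= => /asboolP Aw /asboolP Aw'.
case=> <- /ffunP h; have := h (e, j); rewrite !ffunE eqxx => <-.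
rewrite /set_exponent /= in h; congr (_, _, _).
have h' ek : ek != (e, j) -> w2 ek = w2' ek.
  by move=> /negPf ne; have := h ek; rewrite !ffunE ne.
apply/ffunP => ek; case: (eqVneq ek (e, j)) => [->|/h' //].
by apply: (hA _ _ Aw Aw').
Qed.

Lemma prob_not_distinct : (0 < N)%N ->
  P (fun w : outcome => ~ distinct_exponents w) <=
  ((E * 2) ^ 2 * D)%:R * N%:R^-1.
Proof.
move=> N0.
have -> : ((E * 2) ^ 2 * D = #|{: random_edge E * random_edge E * 'I_D}|)%N.
  by rewrite !card_prod !card_ord card_bool mulnn.
pose A (t : random_edge E * random_edge E * 'I_D) (w : outcome) : Prop :=
  t.1.1 <> t.1.2 /\ w.2 (t.1.1, t.2) = w.2 (t.1.2, t.2).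
apply: (@le_trans _ _ (P (fun w : outcome => exists t, A t w))).
  apply: uniform_prob_le => w nd; apply: contrapT => nA; apply: nd => e f ef j.
  by apply/eqP => wef; apply: nA; exists (e, f, j).
apply: uniform_prob_exists => -[[e f] j]; rewrite -[N in N%:R]card_ord.
apply: (@uniform_prob_injective _ _ _ _ (fun z => set_exponent z e j)).
  by rewrite card_ord.
apply: set_exponent_inj => w w' [/= ef h] [_ h'] hw; rewrite h h'; apply: hw.
by rewrite xpair_eqE eqxx andbT eq_sym; apply/eqP.
Qed.

Lemma prob_zero_exponent j : (0 < N)%N ->
  P (fun w : outcome => exists e, ~ (w.2 (e, j) != 0 :> nat)) <=
  (E * 2)%:R * N%:R^-1.
Proof.
move=> N0.
have -> : (E * 2 = #|{: random_edge E}|)%N by rewrite card_prod card_ord card_bool.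
pose A e (w : outcome) : Prop := ~ (w.2 (e, j) != 0 :> nat).
apply: (uniform_prob_exists (A := A)) => e; rewrite -[N in N%:R]card_ord.
apply: (@uniform_prob_injective _ _ _ _ (fun z => set_exponent z e j)).
  by rewrite card_ord.
apply: set_exponent_inj => w w' /negP/negPn/eqP h /negP/negPn/eqP h' _.
by apply: val_inj; rewrite /= h h'.
Qed.

Definition half_edge : finType := ('I_V * bool * {ffun 'I_D -> 'I_N})%type.

(* [(i, b)] carries its terminal vertex, which is the initial vertex of
   [(i, ~~ b)], next to its label. *)
Definition half_edges (w : outcome) : {ffun 'I_E -> {ffun bool -> half_edge}} :=
  [ffun i => [ffun b => (w.1.1 (i, ~~ b), w.1.2 (i, b), [ffun k => w.2 ((i, b), k)])]].

(** With [card_half_edges], the regrouping is a bijection, so the 2E half edges are independent and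
    uniform. *)
Lemma half_edges_inj : injective half_edges.
Proof.
move=> [[v s] a] [[v' s'] a'] /ffunP h.
have {}h i b : (v (i, ~~ b), s (i, b), [ffun k => a ((i, b), k)]) =
    (v' (i, ~~ b), s' (i, b), [ffun k => a' ((i, b), k)]) :> half_edge.
  by have /ffunP/(_ b) := h i; rewrite !ffunE.
congr (_, _, _); apply/ffunP.
- by case=> i b; have [+ _ _] := h i (~~ b); rewrite negbK.
- by case=> i b; have [_ + _] := h i b.
by case=> -[i b] k; have [_ _ /ffunP/(_ k)] := h i b; rewrite !ffunE.
Qed.

Lemma card_half_edge : #|half_edge| = (V * 2 * N ^ D)%N.
Proof. by rewrite !card_prod card_ffun !card_ord card_bool. Qed.

Lemma card_half_edges : #|{: outcome}| = #|{: {ffun 'I_E -> {ffun bool -> half_edge}}}|.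
Proof.
rewrite !card_ffun card_half_edge card_bool !card_prod !card_ffun !card_prod.
rewrite !card_ord card_bool -[RHS]expnM [(2 * E)%N]mulnC !expnMn.
by rewrite -[((N ^ D) ^ _)%N]expnM [(D * _)%N]mulnC.
Qed.

Lemma mean_half_edge (f : 'I_V -> R) (g : {ffun 'I_D -> 'I_N} -> R) :
  mean (fun x : half_edge => f x.1.1 * g x.2) = mean f * mean g.
Proof.
rewrite (mean_pair (fun y : 'I_V * bool => f y.1)); congr (_ * _).
rewrite -[RHS]mulr1 -(@mean_const R bool 1) ?card_bool // -mean_pair.
by apply: eq_mean => y; rewrite mulr1.
Qed.

Lemma prob_not_all_joined : (0 < V)%N -> (0 < N)%N ->
  P (fun w : outcome => ~ all_joined w) <=
  (V ^ 2)%:R * (1 - V%:R^-1 ^+ 2) ^+ E.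
Proof.
move=> V0 N0.
have -> : (V ^ 2 = #|{: 'I_V * 'I_V}|)%N by rewrite card_prod !card_ord.
pose A (t : 'I_V * 'I_V) (w : outcome) : Prop :=
  forall i, ~ (w.1.1 (i, false) = t.1 /\ w.1.1 (i, true) = t.2).
apply: (@le_trans _ _ (P (fun w : outcome => exists t, A t w))).
  apply: uniform_prob_le => w nd; apply: contrapT => nA; apply: nd => u v.
  apply: contrapT => nuv; apply: nA; exists (u, v) => i hi; apply: nuv.
  by exists i.
apply: uniform_prob_exists => -[u v].
(* The terminal vertex of [(i, true)] is the initial vertex of [(i, false)], hence [u] goes with
   [true]. *)
pose h (b : bool) (x : half_edge) := x.1.1 == (if b then u else v).
pose Q (x : {ffun bool -> half_edge}) := [forall b, h b (x b)].
apply: (@le_trans _ _ (P (fun w : outcome => [forall i, ~~ Q (half_edges w i)]))).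
  apply: uniform_prob_le => w nd; apply/forallP => i; apply/negP => /forallP hi.
  have := hi true; have := hi false; rewrite !ffunE /h /= => /eqP h1 /eqP h2.
  exact: (nd i).
have := uniform_prob_preim R (fun x : {ffun 'I_E -> {ffun bool -> half_edge}} =>
  [forall i, ~~ Q (x i)]) half_edges_inj card_half_edges.
move/le_trans; apply.
rewrite uniform_probE.
under eq_mean => x do rewrite asboolb natr_forall.
rewrite (mean_ffun_prod (fun _ y => (~~ Q y)%:R)) prodr_const card_ord.
rewrite (@eq_mean _ _ _ (fun y : {ffun bool -> half_edge} =>
  1 - \prod_b (h b (y b))%:R)); last first.
  by move=> y; rewrite -natr_forall -/(Q y); case: (Q y); rewrite ?subrr ?subr0.
rewrite mean1B; last by rewrite card_ffun card_half_edge expn_gt0 !muln_gt0 V0 expn_gt0 N0.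
rewrite (mean_ffun_prod (fun b x => (h b x)%:R)) (eq_bigr (fun=> V%:R^-1)).
  by rewrite prodr_const card_bool.
move=> b _; pose c := if b then u else v.
rewrite (@eq_mean _ _ _ (fun x : half_edge => (x.1.1 == c)%:R * 1)); last first.
  by move=> x; rewrite mulr1.
rewrite (mean_half_edge (fun v => (v == c)%:R) (fun=> 1)) mean_indicator1 card_ord.
by rewrite mean_const ?mulr1 // card_ffun !card_ord expn_gt0 N0.
Qed.

Definition below (y x : half_edge) : bool :=
  (y.1.1 == x.1.1) && [forall k, (y.2 k <= x.2 k)%N].

Lemma prob_not_dominated :
  P (fun w : outcome => exists i, forall b, ~ dominated w i b) <=
  E%:R * (mean (fun x => (mean (fun y => (~~ below y x)%:R : R)) ^+ E.-1)) ^+ 2.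
Proof.
rewrite -[E in E%:R * _]card_ord; apply: uniform_prob_exists => i.
pose Q (y x : {ffun bool -> half_edge}) := [forall b, ~~ below (y b) (x b)].
apply: (@le_trans _ _ (P (fun w : outcome =>
    [forall (i' | i' != i), Q (half_edges w i') (half_edges w i)]))).
  apply: uniform_prob_le => w nd; apply/forall_inP => i' ne; apply/forallP => b; apply/negP.
  rewrite !ffunE => /andP[/eqP /= h1 /forallP h2]; apply: (nd b).
  exists i' => //; split => // k; by have := h2 k; rewrite !ffunE.
have := uniform_prob_preim R (fun x : {ffun 'I_E -> {ffun bool -> half_edge}} =>
  [forall (i' | i' != i), Q (x i') (x i)]) half_edges_inj card_half_edges.
move/le_trans; apply.
rewrite uniform_probE.
under eq_mean => x do rewrite asboolb natr_forall_in.
rewrite (mean_ffun_condition _ (fun y x => (Q y x)%:R)) card_ord.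
(* For a fixed pair [u] of half edges, the inner mean of [Q] factors over the bit [b]; so does its
   power, and averaging over [u] gives a square. *)
pose q (x : half_edge) : R := mean (fun y => (~~ below y x)%:R) ^+ E.-1.
rewrite -[X in _ <= X ^+ 2]/(mean q).
rewrite (@eq_mean _ _ _ (fun u : {ffun bool -> half_edge} => \prod_b q (u b))).
  by rewrite (mean_ffun_prod (fun=> q)) prodr_const card_bool.
move=> u; rewrite prodrXl; congr (_ ^+ _).
rewrite -(mean_ffun_prod (fun b y => (~~ below y (u b))%:R)).
by apply: eq_mean => y; rewrite natr_forall.
Qed.

Lemma mean_below (x : half_edge) : (0 < V)%N -> (0 < N)%N ->
  mean (fun y => (~~ below y x)%:R : R) =
  1 - V%:R^-1 * \prod_k ((x.2 k).+1%:R / N%:R).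
Proof.
move=> V0 N0.
rewrite (@eq_mean _ _ _ (fun y : half_edge => 1 - (y.1.1 == x.1.1)%:R *
  \prod_k ((y.2 k <= x.2 k)%N)%:R)); last first.
  move=> y; rewrite -natr_forall -natrM mulnb -/(below y x).
  by case: (below y x); rewrite ?subrr ?subr0.
rewrite mean1B; last by rewrite card_half_edge !muln_gt0 V0 expn_gt0 N0.
rewrite (mean_half_edge (fun v => (v == x.1.1)%:R)
  (fun a : {ffun 'I_D -> 'I_N} => \prod_k ((a k <= x.2 k)%N)%:R)) mean_indicator1 card_ord.
rewrite (mean_ffun_prod (fun k (a : 'I_N) => ((a <= x.2 k)%N)%:R)).
congr (1 - _ * _); apply: eq_bigr => k _; rewrite /mean card_ord; congr (_ / _).
rewrite -natr_sum; congr _%:R.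
have lt_N : ((x.2 k).+1 <= N)%N := ltn_ord _.
(* Since [x.2 k < N], exactly [(x.2 k).+1] values of the exponent are at most [x.2 k]. *)
transitivity (\sum_(i < (x.2 k).+1) 1)%N; last by rewrite sum1_card card_ord.
rewrite (big_ord_widen N (fun=> 1%N) lt_N) [RHS]big_mkcond /=.
by apply: eq_bigr => i _; rewrite ltnS; case: leqP.
Qed.

End BadEvents.

(** * Power and exponential inequalities, with [d] in the role of 1 - s *)

Section Estimates.
Variable R : realType.
Implicit Types a t s d : R.

(** Young's inequality for a^d and 1 with conjugate exponents 1/d and 1/(1-d). *)
Lemma powR_bernoulli a d : 0 <= a -> 0 < d < 1 -> a `^ d <= 1 - d + d * a.
Proof.
move=> a0 /andP[d0 d1].
have := @conjugate_powR _ (a `^ d) 1 d^-1 (1 - d)^-1 (powR_ge0 _ _) ler01.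
rewrite !invr_gt0 subr_gt0 !invrK powR1 mulr1 mul1r -powRrM mulfV ?gt_eqF // powRr1 //.
move=> /(_ d0 d1); rewrite [d + _]addrC subrK => /(_ erefl).
by rewrite addrC [a * d]mulrC.
Qed.

(** A discrete form of the integral of x^(d-1). With y = N + 1, the induction step d y^(d-1) <= y^d
    - N^d is [powR_bernoulli] at N/y, scaled by y^d. *)
Lemma sum_powR_le (N : nat) d : 0 < d < 1 ->
  d * \sum_(a < N) a.+1%:R `^ (d - 1) <= N%:R `^ d.
Proof.
move=> d01; have /andP[d0 d1] := d01.
elim: N => [|N IH]; first by rewrite big_ord0 mulr0 powR_ge0.
rewrite big_ord_recr mulrDr /= -lerBrDr; apply: le_trans IH _.
set y : R := N.+1%:R; have y0 : 0 < y by rewrite ltr0n.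
have -> : N%:R = y * (N%:R / y) :> R by rewrite mulrCA divff ?mulr1 // gt_eqF.
rewrite powRM ?divr_ge0 ?(ltW y0) //.
have /(ler_wpM2l (powR_ge0 y d)) : (N%:R / y) `^ d <= 1 - d + d * (N%:R / y).
  by apply: powR_bernoulli; rewrite // divr_ge0 // ltW.
move/le_trans; apply; rewrite powRB ?(gt_eqF y0) ?implybT // powRr1 ?(ltW y0) //.
have -> : N%:R = y - 1 :> R by rewrite /y -natr1 addrK.
rewrite le_eqVlt; apply/predU1P; left; field; rewrite nat1r gt_eqF // ltr0n.
Qed.

Lemma mean_powR_le (N : nat) d : (0 < N)%N -> 0 < d < 1 ->
  mean (fun a : 'I_N => (a.+1%:R / N%:R) `^ (d - 1)) <= d^-1.
Proof.
move=> N0 d01; have /andP[d0 d1] := d01.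
have n0 : 0 < N%:R :> R by rewrite ltr0n.
rewrite /mean card_ord ler_pdivrMr // ler_pdivlMl //.
under eq_bigr => a _ do rewrite powRM ?invr_ge0 // ?ler0n //.
rewrite -mulr_suml mulrA.
apply: (@le_trans _ _ (N%:R `^ d * N%:R^-1 `^ (d - 1))).
  by rewrite ler_wpM2r ?powR_ge0 // sum_powR_le.
rewrite -[N%:R^-1]powR_inv1 ?(ltW n0) // -powRrM -powRD ?(gt_eqF n0) ?implybT //.
by rewrite mulN1r opprB addrC subrK powRr1 // ltW.
Qed.

(** After taking logarithms the claim is s ln t <= t, which follows from ln t < t when ln t >= 0 and
    from signs otherwise. *)
Lemma expRN_le_powR t s : 0 < t -> 0 <= s <= 1 -> expR (- t) <= t `^ (- s).
Proof.
move=> t0 /andP[s0 s1]; rewrite /powR gt_eqF // ler_expR mulNr lerN2.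
have [l0|l0] := leP 0 (ln t).
  by apply: le_trans (ler_wpM2r l0 s1) _; rewrite mul1r ltW // ln_sublinear.
by apply: (@le_trans _ _ 0); [rewrite mulr_ge0_le0 // ltW | exact: ltW].
Qed.

Lemma powR_prod (I : finType) (f : I -> R) s : (forall i, 0 <= f i) ->
  (\prod_i f i) `^ s = \prod_i f i `^ s.
Proof.
move=> f0; suff [] : (\prod_i f i) `^ s = \prod_i f i `^ s /\ 0 <= \prod_i f i by [].
elim/big_rec2: _ => [|i y z _ [<- z0]]; first by rewrite powR1.
by rewrite powRM // mulr_ge0.
Qed.

(** From (1 - F/V)^n <= exp (- n F / V) <= (n F / V)^(d-1); the last power factors over the D
    exponents, each factor having mean at most 1/d. *)
Lemma mean_not_below_le (V D N n : nat) d :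
  (0 < V)%N -> (0 < N)%N -> (0 < n)%N -> 0 < d < 1 ->
  mean (fun x : half_edge V D N => (mean (fun y => (~~ below y x)%:R : R)) ^+ n) <=
  (n%:R / V%:R) `^ (d - 1) * d^-1 ^+ D.
Proof.
move=> V0 N0 n0 d01; have /andP[d0 d1] := d01.
have vR : 0 < V%:R :> R by rewrite ltr0n.
have NR : 0 < N%:R :> R by rewrite ltr0n.
have nR : 0 < n%:R :> R by rewrite ltr0n.
pose g (a : 'I_N) : R := (a.+1%:R / N%:R) `^ (d - 1).
have F0 (a : 'I_N) : 0 < a.+1%:R / N%:R :> R by rewrite divr_gt0 ?ltr0n.
apply: (@le_trans _ _ (mean (fun x : half_edge V D N =>
    (n%:R / V%:R) `^ (d - 1) * \prod_k g (x.2 k)))); last first.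
  rewrite (mean_half_edge (fun=> (n%:R / V%:R) `^ (d - 1))
    (fun a : {ffun 'I_D -> 'I_N} => \prod_k g (a k))).
  rewrite mean_const ?card_ord // ler_wpM2l ?powR_ge0 //.
  rewrite (mean_ffun_prod (fun=> g)) prodr_const card_ord.
  rewrite lerXn2r ?nnegrE ?invr_ge0 ?(ltW d0) ?mean_powR_le //.
  by apply: mean_ge0 => a; apply: powR_ge0.
apply: ler_mean => x; set F := \prod_k ((x.2 k).+1%:R / N%:R) : R.
have FP : 0 < F by apply: prodr_gt0.
rewrite -powR_prod; last by move=> i; apply: ltW.
rewrite -/F -powRM ?divr_ge0 // ?(ltW FP) //.
apply: (@le_trans _ _ (expR (- (n%:R / V%:R * F)))); last first.
  rewrite -[d - 1]opprB expRN_le_powR ?mulr_gt0 ?invr_gt0 //.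
  by rewrite subr_ge0 ltW // lerBlDr lerDl ltW.
have -> : - (n%:R / V%:R * F) = n%:R * (- (V%:R^-1 * F)) by ring.
rewrite expRM_natl lerXn2r ?nnegrE ?expR_ge0 ?mean_ge0 //.
by rewrite mean_below // expR_ge1Dx.
Qed.

End Estimates.

(** * Inequalities between exponents, with [L] = ln E and [v] = ln V *)

Section Numerics.
Variable R : realType.
Variables (eps L v D : R).
Hypotheses (eps_gt0 : 0 < eps) (eps_lt : eps < 1 / 50).
Hypotheses (D_ge1 : 1 <= D) (D_le : 2 * D <= eps ^+ 2 * L).
Hypotheses (v_ge0 : 0 <= v) (v_le : (2 + eps) * v <= L).

Lemma epsL_ge100 : 100 <= eps * L.
Proof.
have [e0 e1] := (eps_gt0, eps_lt); have [D1 DL] := (D_ge1, D_le).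
have h : 2 <= eps * (eps * L) by move: D_le; rewrite expr2 -mulrA; lra.
have L0 : 0 < eps * L by rewrite -(pmulr_rgt0 _ eps_gt0); lra.
have := ler_wpM2r (ltW L0) (ltW eps_lt); lra.
Qed.

Lemma L_ge5000 : 5000 <= L.
Proof.
have [e0 e1] := (eps_gt0, eps_lt).
have := epsL_ge100 => h; have L0 : 0 < L by rewrite -(pmulr_rgt0 _ eps_gt0); lra.
have := ler_wpM2r (ltW L0) (ltW eps_lt); lra.
Qed.

(** Multiply 2 <= eps^2 L by L. This lets a quadratic term in eps L absorb L. *)
Lemma L_le_sqr : L <= (eps * L) ^+ 2 / 2.
Proof.
have [e0 e1] := (eps_gt0, eps_lt); have [D1 DL] := (D_ge1, D_le).
have L0 := L_ge5000; have h : 2 <= eps ^+ 2 * L by lra.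
have L0' : 0 <= L by lra.
have := ler_wpM2r L0' h; rewrite exprMn expr2 [L ^+ 2]expr2; lra.
Qed.

Lemma v_le_half : v <= L / 2.
Proof. by have := mulr_ge0 (ltW eps_gt0) v_ge0; move: v_le; lra. Qed.

(** The logarithm of the bound V^2 exp (- E / V^2). With x = eps L, exp (x/3) >= x^4/1944 >= 5 x^2
    outweighs 2v <= L <= x^2/2 and the linear terms. *)
Lemma joined_exponent : 2 * v - expR (L - 2 * v) <= - (eps * L / 8) - 2.
Proof.
have [e0 e1] := (eps_gt0, eps_lt); have [v0 vL] := (v_ge0, v_le).
have h100 := epsL_ge100; have hL := L_le_sqr; have hv := v_le_half.
set x := eps * L in h100 hL *.
have L_v : x / 3 <= L - 2 * v.
  have h1 : eps * v <= x / 2.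
    by have := ler_wpM2l (ltW eps_gt0) hv; rewrite /x; lra.
  have ev0 := mulr_ge0 (ltW eps_gt0) v_ge0.
  have L0 := L_ge5000.
  (* The two sides differ by 2 (L - (2 + eps) v). *)
  have h2 : x <= (2 + eps) * (L - 2 * v) by move: v_le; rewrite /x; lra.
  have h3 : 0 <= L - 2 * v by lra.
  have h4 : (2 + eps) * (L - 2 * v) <= 3 * (L - 2 * v) by rewrite ler_wpM2r //; lra.
  lra.
have e4 : 1 + (x / 3) ^+ 4 / 4`!%:R <= expR (x / 3) by apply: expR_ge1Dxn; lra.
have e5 : expR (x / 3) <= expR (L - 2 * v) by rewrite ler_expR.
have x2 : 10000 <= x ^+ 2 by rewrite expr2; nra.
have x4 : (x / 3) ^+ 4 / 4`!%:R = x ^+ 2 * x ^+ 2 / 1944.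
  by rewrite (_ : 4`! = 24)%N //; field.
have : x ^+ 2 * 5 <= x ^+ 2 * x ^+ 2 / 1944 by nra.
have : 100 * x <= x ^+ 2 by rewrite expr2; nra.
lra.
Qed.

Lemma eps_ln_le : eps * ln (8 / eps) <= 4 / 25.
Proof.
have [e0 e1] := (eps_gt0, eps_lt).
have z0 : 0 < 1 / (50 * eps) by rewrite divr_gt0 // mulr_gt0.
(* The factor 1/(50 eps) exceeds 1 and is handled by ln z <= z - 1; the bound is then 7 eps + 1/50 <
   8/50. *)
have -> : 8 / eps = 400 * (1 / (50 * eps)) by field; rewrite gt_eqF.
rewrite lnM ?posrE // mulrDr.
have l400 : ln 400 <= 8 :> R.
  rewrite -ler_expR lnK ?posrE //.
  have : 1 + 8 ^+ 8 / 8`!%:R <= expR 8 :> R by apply: expR_ge1Dxn.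
  apply: le_trans; rewrite (_ : 8`! = 40320)%N //; lra.
have lz : ln (1 / (50 * eps)) <= 1 / (50 * eps) - 1.
  by rewrite -[X in ln X](subrKC 1) le_ln1Dx //; lra.
have h1 := ler_wpM2l (ltW eps_gt0) l400.
have h2 := ler_wpM2l (ltW eps_gt0) lz.
have h3 : eps * (1 / (50 * eps) - 1) = 1 / 50 - eps by field; rewrite gt_eqF.
lra.
Qed.

(** The logarithm of the bound on E q^2, with ln (E - 1) replaced by L - 1. With x = eps L, the gain
    99/200 x in 2v pays for x/8 from the choice of s, 4/25 x from the D factors, the target x/8 and
    the constants, as x >= 100. *)
Lemma minimal_exponent :
  L - 2 * (1 - eps / 8) * (L - 1 - v) + 2 * D * ln (8 / eps) <=
  - (eps * L / 8) - 2.
Proof.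
have [e0 e1] := (eps_gt0, eps_lt); have [v0 vL] := (v_ge0, v_le).
have [D1 DL] := (D_ge1, D_le).
have h100 := epsL_ge100; have hln := eps_ln_le; have L0 := L_ge5000.
set l := ln (8 / eps) in hln *; set x := eps * L in h100 *.
have l0 : 0 <= l by rewrite ln_ge0 // ler_pdivlMr //; lra.
have hD : 2 * D * l <= 4 / 25 * x.
  apply: le_trans (ler_wpM2r l0 D_le) _.
  have -> : eps ^+ 2 * L * l = x * (eps * l) by rewrite /x; ring.
  by rewrite mulrC ler_wpM2r //; lra.
have x0 : 0 <= x by lra.
have ex : eps * x <= x / 50 by have := ler_wpM2r x0 (ltW e1); lra.
(* The constant 99/200 lies just below 1/(2 + eps), as eps < 1/50. *)
have hv : 2 * v <= L - 99 / 200 * x.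
  have : 0 <= (2 + eps) * (L - 99 / 200 * x - 2 * v).
    have -> : (2 + eps) * (L - 99 / 200 * x - 2 * v) =
      2 * (L - (2 + eps) * v) + (x / 100 - 99 / 200 * (eps * x)).
      by rewrite /x; field.
    lra.
  by rewrite pmulr_rge0; lra.
have s0 : 0 <= 1 - eps / 8 by lra.
have hsv := ler_wpM2l s0 hv.
have -> : L - 2 * (1 - eps / 8) * (L - 1 - v) = (1 - eps / 8) * (2 * v) -
    (1 - eps / 8) * L + 2 * (1 - eps / 8) - L + x / 8 + L by rewrite /x; field.
have e2 : (1 - eps / 8) * (L - 99 / 200 * x) = (1 - eps / 8) * L - 99 / 200 * x +
  99 / 1600 * (eps * x) by field.
lra.
Qed.

End Numerics.

(** * Each bad event gets a quarter of the allowed probability *)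

Section Bounds.
Variable R : realType.

(** Since e >= 2, the margin 2 in the exponent is worth a factor 1/4. *)
Lemma expR_le_quarter (y z : R) : y <= z - 2 -> expR y <= expR z / 4.
Proof.
rewrite -ler_expR expRB => /le_trans; apply.
rewrite ler_wpM2l ?expR_ge0 // lef_pV2 ?posrE ?expR_gt0 //.
have e1 : 1 + 1 <= expR 1 :> R := expR_ge1Dx 1.
have -> : expR 2 = expR 1 * expR 1 :> R by rewrite -expRD.
nra.
Qed.

Variables (eps : R) (V E D N : nat).
Hypotheses (V_gt0 : (0 < V)%N) (E_gt0 : (0 < E)%N).
Hypotheses (D_gt0 : (0 < D)%N) (N_gt0 : (0 < N)%N).
Hypotheses (eps_gt0 : 0 < eps) (eps_lt : eps < 1 / 50).
Hypotheses (E_ge_V : V%:R `^ (2 + eps) <= E%:R :> R)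
  (E_ge_D : expR (2 * D%:R / eps ^+ 2) <= E%:R :> R) (N_ge_E : (E ^ 4 <= N)%N).

Local Notation L := (ln E%:R : R).
Local Notation v := (ln V%:R : R).

Let D_ge1 : 1 <= D%:R :> R. Proof. by rewrite ler1n. Qed.
Let E_gt0R : 0 < E%:R :> R. Proof. by rewrite ltr0n. Qed.
Let V_gt0R : 0 < V%:R :> R. Proof. by rewrite ltr0n. Qed.

Let D_le : 2 * D%:R <= eps ^+ 2 * L.
Proof.
rewrite [eps ^+ 2 * _]mulrC -ler_pdivrMr ?exprn_gt0 //.
by rewrite -ler_expR lnK ?posrE.
Qed.

Let v_ge0 : 0 <= v. Proof. by rewrite ln_ge0 // ler1n. Qed.

Let v_le : (2 + eps) * v <= L.
Proof. by rewrite -ln_powR ler_ln ?posrE ?powR_gt0. Qed.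

Let expR_L : expR L = E%:R. Proof. by rewrite lnK ?posrE. Qed.
Let expR_v : expR v = V%:R. Proof. by rewrite lnK ?posrE. Qed.

Lemma E_gt1 : (1 < E)%N.
Proof.
rewrite -(ltr_nat R); have L0 := L_ge5000 eps_gt0 eps_lt D_ge1 D_le.
have := ln_sublinear E_gt0R; lra.
Qed.

(** N >= E^4 leaves 4/E, and 16 <= exp (L - eps L / 8) because L >= 5000. *)
Lemma collision_bound : 4 * E%:R ^+ 3 / N%:R <= expR (- (eps * L / 8)) / 4 :> R.
Proof.
have e1 := eps_lt; have L0 := L_ge5000 eps_gt0 eps_lt D_ge1 D_le.
apply: (@le_trans _ _ (4 * E%:R ^+ 3 / E%:R ^+ 4)).
  rewrite ler_wpM2l ?mulr_ge0 ?exprn_ge0 // lef_pV2 ?posrE ?exprn_gt0 ?ltr0n //.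
  by rewrite -natrX ler_nat.
have -> : 4 * E%:R ^+ 3 / E%:R ^+ 4 = 4 * expR (- L) :> R.
  by rewrite expRN expR_L; field; rewrite gt_eqF.
rewrite ler_pdivlMr // mulrAC -ler_pdivlMr ?expR_gt0 // -expRN opprK -expRD.
apply: le_trans (expR_ge1Dx _).
have l0 : 0 <= L by lra.
have := ler_wpM2r l0 (ltW e1); lra.
Qed.

(** Here D <= E, because 2D <= eps^2 L <= L <= E. The bound serves both coinciding and vanishing
    exponents. *)
Lemma collisions_bound (m : nat) : (m <= (E * 2) ^ 2 * D)%N ->
  m%:R / N%:R <= expR (- (eps * L / 8)) / 4 :> R.
Proof.
move=> m_le; apply: le_trans collision_bound; rewrite ler_wpM2r ?invr_ge0 //.
apply: (@le_trans _ _ (4 * E%:R ^+ 2 * D%:R)).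
  rewrite -natrX -!natrM ler_nat; apply: leq_trans m_le _.
  by rewrite expnMn mulnAC mulnC mulnA.
have DE : D%:R <= E%:R :> R.
  have e1 := eps_lt; have L0 := L_ge5000 eps_gt0 eps_lt D_ge1 D_le.
  have e2 : eps ^+ 2 <= 1 by rewrite exprn_ile1 ?ltW //; lra.
  have l0 : 0 <= L by lra.
  have := ler_wpM2r l0 e2; have := ln_sublinear E_gt0R; have := D_le; have := D_ge1; lra.
by rewrite [E%:R ^+ 3]exprSr mulrA ler_wpM2l // mulr_ge0 ?exprn_ge0.
Qed.

Lemma joined_bound :
  (V ^ 2)%:R * (1 - V%:R^-1 ^+ 2) ^+ E <= expR (- (eps * L / 8)) / 4 :> R.
Proof.
apply: le_trans (expR_le_quarter (joined_exponent eps_gt0 eps_lt D_ge1 D_le v_ge0 v_le)).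
rewrite (expRD (2 * v)) natrX expRM_natl expR_v ler_wpM2l ?exprn_ge0 //.
have -> : - expR (L - 2 * v) = E%:R * (- V%:R^-1 ^+ 2).
  by rewrite expRB expR_L expRM_natl expR_v exprVn mulrN.
have V2 : V%:R^-1 ^+ 2 <= 1 :> R by rewrite exprn_ile1 ?invr_ge0 // invf_le1 ?ler1n.
by rewrite expRM_natl lerXn2r ?nnegrE ?subr_ge0 ?expR_ge0 ?expR_ge1Dx.
Qed.

Lemma minimal_bound :
  E%:R * ((E.-1%:R / V%:R) `^ (eps / 8 - 1) * (eps / 8)^-1 ^+ D) ^+ 2
    <= expR (- (eps * L / 8)) / 4 :> R.
Proof.
have e1 := eps_lt; have L0 := L_ge5000 eps_gt0 eps_lt D_ge1 D_le.
have LE : L <= E%:R by rewrite ltW // ln_sublinear.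
have EE : E.-1%:R = E%:R - 1 :> R by rewrite -subn1 natrB.
apply: le_trans (expR_le_quarter (minimal_exponent eps_gt0 eps_lt D_ge1 D_le v_ge0 v_le)).
have n0 : 0 < E.-1%:R :> R by rewrite EE; lra.
(* Because E/e <= E/2 <= E - 1. *)
have hn : L - 1 <= ln E.-1%:R.
  rewrite -ler_expR lnK ?posrE // expRB expR_L ler_pdivrMr ?expR_gt0 // EE.
  have e2 : 1 + 1 <= expR 1 :> R := expR_ge1Dx 1.
  have := ler_wpM2l (ltW n0) e2; rewrite EE; lra.
have h1 : (E.-1%:R / V%:R) `^ (eps / 8 - 1) <= expR (- (1 - eps / 8) * (L - 1 - v)).
  rewrite /powR gt_eqF ?divr_gt0 // ler_expR ln_div ?posrE // opprB.
  by rewrite ler_wnM2l; lra.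
have h2 : (eps / 8)^-1 ^+ D = expR (D%:R * ln (8 / eps)).
  by rewrite expRM_natl lnK ?posrE ?divr_gt0 // invf_div.
have -> : L - 2 * (1 - eps / 8) * (L - 1 - v) + 2 * D%:R * ln (8 / eps) =
   L + 2%:R * (- (1 - eps / 8) * (L - 1 - v) + D%:R * ln (8 / eps)) by ring.
rewrite expRD expR_L ler_wpM2l // ?ler0n // expRM_natl lerXn2r ?nnegrE ?expR_ge0 //.
  by rewrite mulr_ge0 ?powR_ge0 // h2 expR_ge0.
by rewrite h2 expRD ler_wpM2r ?expR_ge0.
Qed.

End Bounds.

(** * Union bound over the four bad events *)

Theorem theorem3p8 (R : realType) (eps : R) (V E D N : nat)
    (p : 'I_D -> nat) (p_prime : forall j : 'I_D, prime (p j))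
    (p_inj : injective p)
    (eps_gt0 : 0 < eps) (eps_lt : eps < 1 / 50)
    (V_gt0 : (0 < V)%N) (E_gt0 : (0 < E)%N)
    (D_gt0 : (0 < D)%N) (N_gt0 : (0 < N)%N)
    (E_ge_V : V%:R `^ (2 + eps) <= E%:R)
    (E_ge_D : expR (2 * D%:R / eps ^+ 2) <= E%:R)
    (N_ge_E : (E ^ 4 <= N)%N) :
  1 - 1 / E%:R `^ (eps / 8) <=
    uniform_prob R (fun w : outcome V E D N =>
      connected (random_gbs_graph p_prime w) /\
      flexible (random_gbs_graph p_prime w)).
Proof.
have outcome_gt0 : (0 < #|{: outcome V E D N}|)%N.
  by rewrite card_half_edges !card_ffun card_half_edge !expn_gt0 !muln_gt0 V_gt0
             expn_gt0 N_gt0.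
have E_gt0R : 0 < E%:R :> R by rewrite ltr0n.
have -> : 1 / E%:R `^ (eps / 8) = expR (- (eps * ln E%:R / 8)) :> R.
  by rewrite div1r /powR gt_eqF // -expRN mulrAC.
set c : R := expR _.
rewrite -uniform_probC // lerD2l lerN2.
pose k0 := Ordinal D_gt0.
pose bad_distinct (w : outcome V E D N) := ~ distinct_exponents w.
pose bad_zero (w : outcome V E D N) := exists e, ~ (w.2 (e, k0) != 0 :> nat).
pose bad_joined (w : outcome V E D N) := ~ all_joined w.
pose bad_minimal (w : outcome V E D N) := exists i, forall b, ~ dominated w i b.
apply: (@le_trans _ _ (uniform_prob R (fun w =>
    (bad_distinct w \/ bad_zero w) \/ (bad_joined w \/ bad_minimal w)))).
  apply: uniform_prob_le => w ngood; apply: contrapT => nbad; apply: ngood.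
  apply: good_outcome => //.
  - by apply: contrapT => h; apply: nbad; do 2 left.
  - by apply: contrapT => h; apply: nbad; right; left.
  - move=> i; apply: contrapT => h; apply: nbad; right; right; exists i => b hb.
    by apply: h; exists b.
  exists k0 => e; apply: contrapT => h; apply: nbad; left; right.
  by exists e.
rewrite (_ : c = (c / 4 + c / 4) + (c / 4 + c / 4)); last by field.
apply: le_trans (uniform_prob_or _ _ _) (lerD _ _);
  apply: le_trans (uniform_prob_or _ _ _) (lerD _ _).
- apply: le_trans (prob_not_distinct R V E D N_gt0) _.
  exact: (collisions_bound E_gt0 D_gt0 N_gt0 eps_gt0 eps_lt E_ge_D N_ge_E).
- apply: le_trans (prob_zero_exponent R V E k0 N_gt0) _.
  apply: (collisions_bound E_gt0 D_gt0 N_gt0 eps_gt0 eps_lt E_ge_D N_ge_E).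
  (* The count 2E of possible vanishing exponents is at most (2E)^2 D. *)
  by rewrite expnS expn1 -mulnA leq_pmulr // !muln_gt0 E_gt0.
- apply: le_trans (prob_not_all_joined R E D V_gt0 N_gt0) _.
  exact: (joined_bound V_gt0 E_gt0 D_gt0 eps_gt0 eps_lt E_ge_V E_ge_D).
apply: le_trans (prob_not_dominated R V E D N) _.
have E1_gt0 : (0 < E.-1)%N
  by rewrite -ltnS prednK // (E_gt1 E_gt0 D_gt0 eps_gt0 eps_lt E_ge_D).
(* The choice s = 1 - eps/8 means d = eps/8. *)
have d01 : 0 < eps / 8 < 1 by apply/andP; split; lra.
apply: le_trans (minimal_bound V_gt0 E_gt0 D_gt0 eps_gt0 eps_lt E_ge_V E_ge_D).
rewrite ler_wpM2l // lerXn2r ?nnegrE ?mean_ge0 //.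
- by move=> x; rewrite exprn_ge0 // mean_ge0.
- by rewrite mulr_ge0 ?powR_ge0 // exprn_ge0 // invr_ge0 ltW // divr_gt0.
exact: mean_not_below_le.
Qed.
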